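(* Let $\Gamma$ and $\Delta$ be connected graphs. If $\Delta$ is a quasi-retract of $\Gamma$, then \[\mathsf{wCop}(\Delta)\le\mathsf{wCop}(\Gamma)\quad\text{and}\quad\mathsf{sCop}(\Delta)\le\mathsf{sCop}(\Gamma).\]
   Context: Graphs are undirected, without double edges and without loops. For a connected graph $\Gamma$, $\mathsf{dist}$ (or $\mathsf{dist}_\Gamma$) is the path distance on $V(\Gamma)$. Quasi-retract. For metric spaces $X,Y$ and constants $C\ge1$, $D\ge0$, a function $f\colon X\to Y$ is $(C,D)$-Lipschitz if $\mathsf{dist}_Y(f(x_1),f(x_2))\le C\,\mathsf{dist}_X(x_1,x_2)+D$ for all $x_1,x_2\in X$. $X$ is a quasi-retract of $Y$ if there are constants $C\ge1$, $D\ge0$ and $(C,D)$-Lipschitz functions $f\colon X\to Y$ and $g\colon Y\to X$ with $\mathsf{dist}_X(g(f(x)),x)\le D$ for all $x\in X$. A connected graph $\Delta$ is a quasi-retract of a connected graph $\Gamma$ if $V(\Delta)$ is a quasi-retract of $V(\Gamma)$ with respect to the path distances. Game. The cops and robber game on a connected graph $\Gamma$ has parameters: number of cops $n$, cop speed $\sigma$, cop reach $\rho$, robber speed $\psi$, a vertex $v$, and a positive integer $R$. It is a perfect information game. First the $n$ cops choose initial vertices $c^1_0,\dots,c^n_0$; then, knowing these, the robber chooses an initial vertex $r_0$. In stage $k\ge 1$ each cop moves from $c^i_{k-1}$ to a vertex $c^i_k$ with $\mathsf{dist}(c^i_{k-1},c^i_k)\le\sigma$. The robber is captured during stage $k$ if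 $\mathsf{dist}(r_{k-1},c^i_k)\le\rho$ for some $i$. If not captured, the robber moves from $r_{k-1}$ to a vertex $r_k$ such that there is a path from $r_{k-1}$ to $r_k$ of length at most $\psi$ all of whose vertices are at distance larger than $\rho$ from every $c^i_k$. The cops win (protect the $R$-ball centered at $v$) if the robber is captured at some stage or there is $N>0$ such that $\mathsf{dist}(v,r_k)>R$ for all $k\ge N$. $\Gamma$ is $\mathsf{CopWin}(n,\sigma,\rho,\psi,R)$ if for every vertex $v$ of $\Gamma$ the $n$ cops have a winning strategy in the game with parameters $n,\sigma,\rho,\psi,v,R$. $\Gamma$ is $n$-weak cop win if $\exists\,\sigma\in\mathbb{Z}_{>0}\ \exists\,\rho\in\mathbb{Z}_{\ge0}\ \forall\,\psi,R\in\mathbb{Z}_{>0}$: $\Gamma$ is $\mathsf{CopWin}(n,\sigma,\rho,\psi,R)$. $\Gamma$ is $n$-strong cop win if $\exists\,\sigma\in\mathbb{Z}_{>0}\ \forall\,\psi\in\mathbb{Z}_{>0}\ \exists\,\rho\in\mathbb{Z}_{\ge0}\ \forall\,R\in\mathbb{Z}_{>0}$: $\Gamma$ is $\mathsf{CopWin}(n,\sigma,\rho,\psi,R)$. The weak cop number $\mathsf{wCop}(\Gamma)$ (resp. strong cop number $\mathsf{sCop}(\Gamma)$) in $\mathbb{Z}_{>0}\cup\{\infty\}$ is the smallest positive integer $n$ such that $\Gamma$ is $n$-weak (resp. $n$-strong) cop win, and $\infty$ if there is none. *)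

(* Defs.v *)
From Stdlib Require Import Reals Lra Lia List Arith Wf_nat.
From Stdlib Require Fin.
From Stdlib Require Import Classical ClassicalEpsilon.

Set Implicit Arguments.

Definition is_least (P : nat -> Prop) (n : nat) : Prop :=
  P n /\ forall m, P m -> n <= m.

Lemma ex_least (P : nat -> Prop) : (exists n, P n) -> exists n, is_least P n.
Proof.
  intros H.
  destruct (dec_inh_nat_subset_has_unique_least_element P
              (fun n => classic (P n)) H) as [n [Hn _]].
  now exists n.
Qed.

Record graph := Graph {
  vertex :> Type;
  adj : vertex -> vertex -> Prop;
  adj_sym : forall x y, adj x y -> adj y x;
  adj_irrefl : forall x, ~ adj x x
}.

(* [path_in G A n x y]: there is a path of length [n] from [x] to [y] all of
   whose vertices, endpoints included, lie in [A].  Vertices may repeat. *)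
Inductive path_in (G : graph) (A : G -> Prop) : nat -> G -> G -> Prop :=
| path_nil x : A x -> path_in G A 0 x x
| path_cons n x y z :
    A x -> adj G x y -> path_in G A n y z -> path_in G A (S n) x z.

Definition path (G : graph) : nat -> G -> G -> Prop := path_in G (fun _ => True).

Record connected_graph := ConnectedGraph {
  underlying :> graph;
  connected : forall x y : underlying, exists n, path underlying n x y
}.

Definition gdist (G : connected_graph) (x y : G) : nat :=
  proj1_sig (constructive_indefinite_description _
               (ex_least (fun n => path G n x y) (connected G x y))).

Lemma gdist_least (G : connected_graph) (x y : G) :
  is_least (fun n => path G n x y) (gdist G x y).
Proof. unfold gdist. apply proj2_sig. Qed.

Lemma path_trans (G : graph) m n (x y z : G) :
  path G m x y -> path G n y z -> path G (m + n) x z.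
Proof.
  intros H. induction H as [x _ | m x x' y _ Hx _ IH]; intros Hyz; simpl.
  - exact Hyz.
  - eapply path_cons; [exact I | exact Hx | now apply IH].
Qed.

Lemma path_rev (G : graph) n (x y : G) : path G n x y -> path G n y x.
Proof.
  intros H. induction H as [x _ | n x x' y _ Hx _ IH].
  - now constructor.
  - replace (S n) with (n + 1) by lia.
    apply path_trans with x'; [exact IH |].
    apply path_cons with x; [exact I | now apply adj_sym | now constructor].
Qed.

Lemma gdist_sym (G : connected_graph) (x y : G) : gdist G x y = gdist G y x.
Proof.
  destruct (gdist_least G x y) as [H1 H2], (gdist_least G y x) as [H3 H4].
  apply Nat.le_antisymm; [apply H2 | apply H4]; now apply path_rev.
Qed.

Lemma gdist_eq0 (G : connected_graph) (x y : G) : gdist G x y = 0 <-> x = y.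
Proof.
  destruct (gdist_least G x y) as [H1 H2]. split.
  - intros E. rewrite E in H1. now inversion H1.
  - intros <-. assert (gdist G x x <= 0) by (apply H2; now constructor). lia.
Qed.

Lemma gdist_tri (G : connected_graph) (x y z : G) :
  gdist G x y <= gdist G x z + gdist G z y.
Proof.
  apply (gdist_least G x y). apply path_trans with z; apply gdist_least.
Qed.

Definition path_metric (G : connected_graph) : Metric_Space.
Proof.
  refine (Build_Metric_Space G (fun x y => INR (gdist G x y)) _ _ _ _).
  - intros x y. apply Rle_ge, pos_INR.
  - intros x y. now rewrite gdist_sym.
  - intros x y. rewrite <- gdist_eq0. split.
    + intros H. now apply INR_eq.
    + now intros ->.
  - intros x y z. rewrite <- plus_INR. apply le_INR, gdist_tri.
Defined.

Definition coarse_lipschitz (X Y : Metric_Space) (C D : R)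
    (f : Base X -> Base Y) : Prop :=
  forall x1 x2, (dist Y (f x1) (f x2) <= C * dist X x1 x2 + D)%R.

Definition quasi_retract (X Y : Metric_Space) : Prop :=
  exists C D : R, (1 <= C)%R /\ (0 <= D)%R /\
  exists (f : Base X -> Base Y) (g : Base Y -> Base X),
    coarse_lipschitz X Y C D f /\ coarse_lipschitz Y X C D g /\
    forall x, (dist X (g (f x)) x <= D)%R.

Definition graph_quasi_retract (Delta Gamma : connected_graph) : Prop :=
  quasi_retract (path_metric Delta) (path_metric Gamma).

Definition cops (G : graph) (n : nat) : Type := Fin.t n -> G.

(* [next h] is the cops' position in stage [k >= 1], where [h] lists the
   configurations (cops, robber) at times 0, ..., k-1 in this order. *)
Record strategy (G : graph) (n : nat) := Strategy {
  start : cops G n;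
  next : list (cops G n * G) -> cops G n
}.

(* A play is a pair of infinite sequences [c], [r].  The game ends when the
   robber is captured, so the rules constrain a play only up to then; an
   uncaptured robber may always stay in place, so each finite legal play extends
   to an infinite one. *)
Section Play.

Variables (G : connected_graph) (n sigma rho psi : nat).
Variables (c : nat -> cops G n) (r : nat -> G).

Definition history (k : nat) : list (cops G n * G) :=
  map (fun j => (c j, r j)) (seq 0 k).

Definition follows (s : strategy G n) : Prop :=
  c 0 = start s /\ forall k, c (S k) = next s (history (S k)).

Definition captured (k : nat) : Prop :=
  1 <= k /\ exists i, gdist G (r (k - 1)) (c k i) <= rho.

Definition legal_cops_moves : Prop :=
  forall k, 1 <= k -> (forall j, j < k -> ~ captured j) ->
  forall i, gdist G (c (k - 1) i) (c k i) <= sigma.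

Definition legal_robber_moves : Prop :=
  forall k, 1 <= k -> (forall j, j <= k -> ~ captured j) ->
  exists l, l <= psi /\
    path_in G (fun x => forall i, rho < gdist G x (c k i)) l (r (k - 1)) (r k).

Definition cops_win (v : G) (R : nat) : Prop :=
  (exists k, captured k) \/
  (exists N, 0 < N /\ forall k, N <= k -> R < gdist G v (r k)).

End Play.

Definition winning_strategy (G : connected_graph) (n sigma rho psi : nat)
    (v : G) (R : nat) (s : strategy G n) : Prop :=
  forall (c : nat -> cops G n) (r : nat -> G),
    follows G c r s -> legal_robber_moves G rho psi c r ->
    legal_cops_moves G sigma rho c r /\ cops_win G rho c r v R.

Definition CopWin (G : connected_graph) (n sigma rho psi R : nat) : Prop :=
  forall v : G, exists s : strategy G n, winning_strategy G sigma rho psi v R s.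

Definition weak_cop_win (G : connected_graph) (n : nat) : Prop :=
  exists sigma, 0 < sigma /\ exists rho,
  forall psi R, 0 < psi -> 0 < R -> CopWin G n sigma rho psi R.

Definition strong_cop_win (G : connected_graph) (n : nat) : Prop :=
  exists sigma, 0 < sigma /\ forall psi, 0 < psi -> exists rho,
  forall R, 0 < R -> CopWin G n sigma rho psi R.

Inductive extnat := Finite (n : nat) | Infinity.

Definition extnat_le (a b : extnat) : Prop :=
  match a, b with
  | _, Infinity => True
  | Infinity, Finite _ => False
  | Finite m, Finite n => m <= n
  end.

Definition least_positive (P : nat -> Prop) : extnat :=
  match excluded_middle_informative (exists n, 0 < n /\ P n) with
  | left H => Finite (proj1_sig (constructive_indefinite_description _
                                   (ex_least (fun n => 0 < n /\ P n) H)))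
  | right _ => Infinity
  end.

Definition wCop (G : connected_graph) : extnat := least_positive (weak_cop_win G).

Definition sCop (G : connected_graph) : extnat := least_positive (strong_cop_win G).

(* Main.v *)
Require Import Defs.
From Stdlib Require Import Reals Lra Lia List Arith.
From Stdlib Require Import Classical ClassicalEpsilon.

Set Implicit Arguments.

(** Let [f : Delta -> Gamma] and [g : Gamma -> Delta] exhibit [Delta] as a
    quasi-retract of [Gamma], with all constants bounded by one integer [K].
    The cops in [Delta] run a game in [Gamma] in their heads: when the robber of
    [Delta] stands at [r], the imagined robber stands at [f r], the cops of
    [Gamma] answer with positions [c i] dictated by their winning strategy, and
    the cops of [Delta] go to [g (c i)].  Since [g (f r)] is close to [r], an
    imagined robber at distance [d] from [c i] means a real robber at distance
    at most [K * d + 2 * K] from [g (c i)].  Hence a capture in [Gamma] is a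
    capture in [Delta], provided that the reach in [Delta] is large enough, and
    a robber of [Gamma] who leaves the ball around [f v] of radius [K * R + K]
    corresponds to one of [Delta] who leaves the ball around [v] of radius [R]
    ([transferred_strategy_wins]).

    The imagined robber must also obey the rules.  Replacing each edge of a path
    in [Delta] by a geodesic between the [f]-images of its ends gives a path in
    [Gamma] that is at most [2 * K] times longer and stays within [2 * K] of the
    images of the original vertices ([path_in_image]), so it avoids the cops of
    [Gamma] as soon as the reach in [Delta] is at least
    [K * (rho + 2 * K) + 2 * K].  For a given [K], this reach depends only on
    [rho], and the speed [K * sigma + K] only on [sigma]; this is what both orders
    of quantifiers, the weak and the strong one, require ([CopWin_transfer]).

    The reach in [Delta] being generous, the real game may end while the imagined
    one is still going on, after which the imagined robber may break the rules.
    The legality of the cops' moves up to that moment is still guaranteed: one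
    lets the imagined robber stop moving ([winning_strategy_finite_play]). *)

(** * Paths and distances *)

Lemma path_in_trans (G : graph) (A : G -> Prop) m n (x y z : G) :
  path_in G A m x y -> path_in G A n y z -> path_in G A (m + n) x z.
Proof.
  intros H. induction H as [x Hx | m x x' y Hx Hadj _ IH]; intros Hyz; simpl.
  - exact Hyz.
  - apply path_cons with x'; auto.
Qed.

Lemma gdist_path (G : connected_graph) n (x y : G) :
  path G n x y -> gdist G x y <= n.
Proof. intros H. now apply (gdist_least G x y). Qed.

Lemma gdist_adj (G : connected_graph) (x y : G) :
  adj G x y -> gdist G x y <= 1.
Proof.
  intros H. apply gdist_path.
  apply path_cons with y; [exact I | exact H | now constructor].
Qed.

Lemma path_in_ball (G : connected_graph) (B : G -> Prop) n (x y : G) :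
  path G n x y -> (forall z, gdist G x z <= n -> B z) -> path_in G B n x y.
Proof.
  intros H. induction H as [x _ | n x x' y _ Hadj _ IH]; intros HB.
  - constructor. apply HB. now rewrite (proj2 (gdist_eq0 G x x) eq_refl).
  - apply path_cons with x'; [| exact Hadj |].
    + apply HB. rewrite (proj2 (gdist_eq0 G x x) eq_refl). lia.
    + apply IH. intros z Hz. apply HB.
      pose proof (gdist_tri G x z x'). pose proof (gdist_adj G _ _ Hadj). lia.
Qed.

(** A map that stretches edges by at most [L] sends a path to a chain of
    geodesics of length at most [L], none of which leaves the [L]-balls around
    the images of the vertices. *)
Lemma path_in_image (X Y : connected_graph) (f : X -> Y) (L : nat)
    (A : X -> Prop) (B : Y -> Prop)
    (Hf : forall x y, adj X x y -> gdist Y (f x) (f y) <= L)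
    (HAB : forall x, A x -> forall z, gdist Y (f x) z <= L -> B z)
    l (x y : X) :
  path_in X A l x y ->
  exists m, m <= l * L /\ path_in Y B m (f x) (f y).
Proof.
  intros H. induction H as [x Hx | l x x' y Hx Hadj _ IH].
  - exists 0. split; [lia |]. constructor. apply (HAB x Hx).
    rewrite (proj2 (gdist_eq0 Y (f x) (f x)) eq_refl). lia.
  - destruct IH as [m [Hm Hpath]].
    pose proof (Hf x x' Hadj) as Hlen.
    exists (gdist Y (f x) (f x') + m). split; [simpl; lia |].
    apply path_in_trans with (f x'); [| exact Hpath].
    apply path_in_ball; [apply gdist_least |].
    intros z Hz. apply (HAB x Hx). lia.
Qed.

(** * The play that a strategy produces against given robber moves *)

Definition position (G : graph) n (s : strategy G n) (h : list (cops G n * G)) :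
    cops G n :=
  match h with nil => start s | _ => next s h end.

Definition replay (G : graph) n (s : strategy G n) (rs : list G) :
    list (cops G n * G) :=
  fold_left (fun h x => h ++ (position s h, x) :: nil) rs nil.

Definition response (G : graph) n (s : strategy G n) (r : nat -> G) (k : nat) :
    cops G n :=
  position s (replay s (map r (seq 0 k))).

Lemma history_response (G : connected_graph) n (s : strategy G n) (r : nat -> G) k :
  history G (response s r) r k = replay s (map r (seq 0 k)).
Proof.
  unfold history. induction k as [| k IH]; [reflexivity |].
  rewrite seq_S, !map_app, IH. unfold replay at 2.
  rewrite fold_left_app. reflexivity.
Qed.

Lemma position_history (G : connected_graph) n (s : strategy G n) c (r : nat -> G) k :
  position s (history G c r (S k)) = next s (history G c r (S k)).
Proof. reflexivity. Qed.

Lemma response_follows (G : connected_graph) n (s : strategy G n) (r : nat -> G) :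
  follows G (response s r) r s.
Proof.
  split; [reflexivity |]. intros k.
  rewrite <- position_history, history_response. reflexivity.
Qed.

Lemma response_ext (G : graph) n (s : strategy G n) (r r' : nat -> G) k :
  (forall j, j < k -> r j = r' j) -> response s r k = response s r' k.
Proof.
  intros H. unfold response. do 2 f_equal. apply map_ext_in.
  intros j Hj. apply in_seq in Hj. apply H. lia.
Qed.

(** A winning strategy moves the cops legally in stage [k] even if the rules
    bind the robber only before that stage.  The strategy cannot foresee how the
    robber continues, so one may replace the continuation by a robber who stays
    in place from time [k - 1] on, which is legal as long as he is not captured. *)
Lemma winning_strategy_finite_play (G : connected_graph) n sigma rho psi (v : G) R
    (s : strategy G n) (r : nat -> G) (k : nat)
    (Hwin : winning_strategy G sigma rho psi v R s)
    (Hk : 1 <= k)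
    (Hfree : forall j, j < k -> ~ captured G rho (response s r) r j)
    (Hrobber : forall j, 1 <= j < k ->
       exists l, l <= psi /\
         path_in G (fun x => forall i, rho < gdist G x (response s r j i)) l
           (r (j - 1)) (r j))
    (i : Fin.t n) :
  gdist G (response s r (k - 1) i) (response s r k i) <= sigma.
Proof.
  set (r' := fun j => r (Nat.min j (k - 1))).
  assert (Hr' : forall j, j < k -> r' j = r j).
  { intros j Hj. unfold r'. f_equal. lia. }
  assert (Hc' : forall j, j <= k -> response s r' j = response s r j).
  { intros j Hj. apply response_ext. intros m Hm. apply Hr'. lia. }
  rewrite <- (Hc' (k - 1)), <- (Hc' k) by lia.
  refine (proj1 (Hwin _ _ (response_follows G s r') _) k Hk _ i).
  - intros j Hj Hfree'.
    destruct (le_lt_dec k j) as [Hkj | Hjk].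
    + exists 0. split; [lia |].
      replace (r' j) with (r' (j - 1)) by (unfold r'; f_equal; lia).
      constructor. intros i'. apply Nat.nle_gt. intros Hle.
      apply (Hfree' j (Nat.le_refl j)). split; [exact Hj | now exists i'].
    + rewrite (Hc' j), (Hr' j), (Hr' (j - 1)) by lia. apply Hrobber. lia.
  - intros j Hj [Hj1 Hcap]. apply (Hfree j Hj). split; [exact Hj1 |].
    rewrite (Hc' j), (Hr' (j - 1)) in Hcap by lia. exact Hcap.
Qed.

(** * Transfer along a quasi-retraction *)

Section Transfer.

Variables (Delta Gamma : connected_graph) (f : Delta -> Gamma) (g : Gamma -> Delta).
Variable (K : nat).
Hypothesis (f_lipschitz :
  forall x y, gdist Gamma (f x) (f y) <= K * gdist Delta x y + K).
Hypothesis (g_lipschitz :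
  forall x y, gdist Delta (g x) (g y) <= K * gdist Gamma x y + K).
Hypothesis (gf_near : forall x, gdist Delta (g (f x)) x <= K).

(** The positions of the cops in [Delta] are ignored: the cops of [Gamma] are
    recomputed from the robber's moves alone. *)
Definition transfer_strategy n (s : strategy Gamma n) : strategy Delta n :=
  {| start := fun i => g (start s i);
     next := fun h i => g (position s (replay s (map (fun p => f (snd p)) h)) i) |}.

Lemma transfer_strategy_response n (s : strategy Gamma n) c r :
  follows Delta c r (transfer_strategy s) ->
  forall k, c k = fun i => g (response s (fun j => f (r j)) k i).
Proof.
  intros [H0 HS] [| k]; [exact H0 |].
  rewrite HS. cbn [next transfer_strategy]. unfold history, response.
  now rewrite map_map.
Qed.

Lemma gdist_pullback (x : Delta) (y : Gamma) d :
  gdist Gamma (f x) y <= d -> gdist Delta x (g y) <= K * d + 2 * K.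
Proof.
  intros H. pose proof (gdist_tri Delta x (g y) (g (f x))) as Htri.
  rewrite (gdist_sym Delta x (g (f x))) in Htri.
  pose proof (gf_near x). pose proof (g_lipschitz (f x) y). nia.
Qed.

Lemma transferred_strategy_wins n sigma rho psi (v : Delta) R (s : strategy Gamma n) :
  winning_strategy Gamma sigma rho (psi * (2 * K)) (f v) (K * R + K) s ->
  winning_strategy Delta (K * sigma + K) (K * (rho + 2 * K) + 2 * K) psi v R
    (transfer_strategy s).
Proof.
  intros Hwin c r Hfollows Hlegal.
  pose proof (transfer_strategy_response Hfollows) as Hc.
  set (r' := fun j => f (r j)) in *. set (c' := response s r') in *.
  set (rho' := K * (rho + 2 * K) + 2 * K) in *.
  assert (Hcap : forall k, captured Gamma rho c' r' k -> captured Delta rho' c r k).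
  { intros k [Hk [i Hi]]. split; [exact Hk |]. exists i. rewrite Hc.
    pose proof (gdist_pullback _ _ Hi). unfold rho'. nia. }
  assert (Hrobber : forall k, 1 <= k ->
    (forall j, j <= k -> ~ captured Delta rho' c r j) ->
    exists l, l <= psi * (2 * K) /\
      path_in Gamma (fun x => forall i, rho < gdist Gamma x (c' k i)) l
        (r' (k - 1)) (r' k)).
  { intros k Hk Hfree. destruct (Hlegal k Hk Hfree) as [l [Hl Hpath]].
    edestruct (@path_in_image Delta Gamma f (2 * K))
      with (B := fun x => forall i, rho < gdist Gamma x (c' k i)) (3 := Hpath)
      as [m [Hm Hpath']].
    - intros x y Hxy. pose proof (gdist_adj Delta _ _ Hxy).
      pose proof (f_lipschitz x y). nia.
    - intros x Hx z Hz i. apply Nat.nle_gt. intros Hle.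
      specialize (Hx i). rewrite Hc in Hx.
      assert (Hnear : gdist Gamma (f x) (c' k i) <= rho + 2 * K).
      { pose proof (gdist_tri Gamma (f x) (c' k i) z). lia. }
      pose proof (gdist_pullback _ _ Hnear). unfold rho' in Hx. lia.
    - exists m. split; [nia | exact Hpath']. }
  split.
  - intros k Hk Hfree i. rewrite !Hc.
    assert (Hstep : gdist Gamma (c' (k - 1) i) (c' k i) <= sigma).
    { apply (winning_strategy_finite_play Hwin Hk).
      - intros j Hj Hj'. exact (Hfree j Hj (Hcap j Hj')).
      - intros j Hj. apply Hrobber; [lia |]. intros m Hm. apply Hfree. lia. }
    pose proof (g_lipschitz (c' (k - 1) i) (c' k i)). nia.
  - destruct (classic (exists k, captured Delta rho' c r k)) as [Hex | Hnever].
    { now left. }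
    destruct (Hwin c' r' (response_follows Gamma s r')) as [_ [[k Hk] | [N [HN Hfar]]]].
    + intros k Hk _. apply Hrobber; [exact Hk |].
      intros j _ Hj. apply Hnever. now exists j.
    + left. exists k. now apply Hcap.
    + right. exists N. split; [exact HN |]. intros k Hk.
      pose proof (Hfar k Hk) as Hd. pose proof (f_lipschitz v (r k)) as Hlip.
      unfold r' in Hd. nia.
Qed.

Lemma CopWin_transfer n sigma rho psi R :
  CopWin Gamma n sigma rho (psi * (2 * K)) (K * R + K) ->
  CopWin Delta n (K * sigma + K) (K * (rho + 2 * K) + 2 * K) psi R.
Proof.
  intros H v. destruct (H (f v)) as [s Hs].
  exists (transfer_strategy s). now apply transferred_strategy_wins.
Qed.

Hypothesis (K_pos : 0 < K).

Lemma weak_cop_win_transfer n : weak_cop_win Gamma n -> weak_cop_win Delta n.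
Proof.
  intros [sigma [Hsigma [rho H]]].
  exists (K * sigma + K). split; [lia |].
  exists (K * (rho + 2 * K) + 2 * K). intros psi R Hpsi HR.
  apply CopWin_transfer, H; nia.
Qed.

Lemma strong_cop_win_transfer n : strong_cop_win Gamma n -> strong_cop_win Delta n.
Proof.
  intros [sigma [Hsigma H]].
  exists (K * sigma + K). split; [lia |]. intros psi Hpsi.
  destruct (H (psi * (2 * K))) as [rho Hrho]; [nia |].
  exists (K * (rho + 2 * K) + 2 * K). intros R HR.
  apply CopWin_transfer, Hrho. nia.
Qed.

End Transfer.

(** * Integer constants and cop numbers *)

Lemma coarse_lipschitz_nat (X Y : connected_graph) (C D : R) (K : nat) (f : X -> Y) :
  (C <= INR K)%R -> (D <= INR K)%R ->
  coarse_lipschitz (path_metric X) (path_metric Y) C D f ->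
  forall x y, gdist Y (f x) (f y) <= K * gdist X x y + K.
Proof.
  intros HC HD H x y. apply INR_le. rewrite plus_INR, mult_INR.
  specialize (H x y). simpl in H.
  pose proof (Rmult_le_compat_r _ _ _ (pos_INR (gdist X x y)) HC). lra.
Qed.

Lemma quasi_retract_nat (X Y : connected_graph) :
  graph_quasi_retract X Y ->
  exists (K : nat) (f : X -> Y) (g : Y -> X), 0 < K /\
    (forall x y, gdist Y (f x) (f y) <= K * gdist X x y + K) /\
    (forall x y, gdist X (g x) (g y) <= K * gdist Y x y + K) /\
    (forall x, gdist X (g (f x)) x <= K).
Proof.
  intros [C [D [HC [HD [f [g [Hf [Hg Hgf]]]]]]]].
  destruct (INR_unbounded (C + D)) as [K HK].
  exists K, f, g. split; [| split; [| split]].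
  - apply INR_lt. simpl. lra.
  - apply coarse_lipschitz_nat with C D; [lra | lra | exact Hf].
  - apply coarse_lipschitz_nat with C D; [lra | lra | exact Hg].
  - intros x. apply INR_le. specialize (Hgf x). simpl in Hgf. lra.
Qed.

Lemma least_positive_antitone (P Q : nat -> Prop) :
  (forall n, P n -> Q n) -> extnat_le (least_positive Q) (least_positive P).
Proof.
  intros H. unfold least_positive.
  destruct (excluded_middle_informative (exists n, 0 < n /\ P n)) as [HP | HP];
    destruct (excluded_middle_informative (exists n, 0 < n /\ Q n)) as [HQ | HQ];
    simpl; try exact I.
  - destruct (constructive_indefinite_description _ (ex_least _ HP)) as [p [[Hp Pp] Hleast_p]].
    destruct (constructive_indefinite_description _ (ex_least _ HQ)) as [q [HQq Hq]].
    simpl. apply Hq. auto.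
  - destruct HP as [p [Hp Pp]]. apply HQ. exists p. auto.
Qed.

Theorem theorem5 (Gamma Delta : connected_graph)
    (Hretract : graph_quasi_retract Delta Gamma) :
  extnat_le (wCop Delta) (wCop Gamma) /\ extnat_le (sCop Delta) (sCop Gamma).
Proof.
  destruct (quasi_retract_nat Hretract) as [K [f [g [HK [Hf [Hg Hgf]]]]]].
  split; apply least_positive_antitone; intros n.
  - exact (weak_cop_win_transfer Delta f g Hf Hg Hgf HK (n := n)).
  - exact (strong_cop_win_transfer Delta f g Hf Hg Hgf HK (n := n)).
Qed.
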